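(* Let $p$ be a prime with $p\equiv 1\pmod 4$, and let $b\in\mathbb{Z}$ with $\left(\frac{b^2-4}{p}\right)=-1$. Then $$\left(\frac{D_p(b,1)}{p}\right)=\left(\frac{2b}{p}\right).$$
   Context: For an odd prime $p$, $\left(\frac{\cdot}{p}\right)$ denotes the Legendre symbol (equal to $0$ on multiples of $p$). For $b,c\in\mathbb{Z}$, $D_p(b,c)$ denotes the integer determinant of the $(p-1)\times(p-1)$ matrix with $(i,j)$ entry $(i^2+bij+cj^2)^{p-2}$: $$D_p(b,c)=\left|(i^2+bij+cj^2)^{p-2}\right|_{1\le i,j\le p-1}.$$ *)

(* Defs.v *)
From mathcomp Require Import all_boot all_order all_algebra.

Set Implicit Arguments.
Unset Strict Implicit.
Unset Printing Implicit Defensive.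

Import GRing.Theory.
Local Open Scope ring_scope.

(* Meaningful only for p an odd prime. *)
Definition legendre (a : int) (p : nat) : int :=
  if (p%:Z %| a)%Z then 0
  else if [exists x : 'I_p, (x%:Z ^+ 2 == a %[mod p%:Z])%Z] then 1
  else -1.

(* Ordinals start at 0, hence the shifts: the indices i, j of the determinant run over 1..p-1. *)
Definition Dmx (p : nat) (b c : int) : 'M[int]_(p.-1) :=
  \matrix_(i < p.-1, j < p.-1)
    ((i.+1)%:Z ^+ 2 + b * (i.+1)%:Z * (j.+1)%:Z + c * (j.+1)%:Z ^+ 2)
      ^+ (p - 2)%N.

Definition D (p : nat) (b c : int) : int := \det (Dmx p b c).

(* Main.v *)
Require Import Defs.
From mathcomp Require Import all_boot all_order all_algebra all_field.
From mathcomp Require Import ring zify.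

(** Modulo p the entries are the inverses of i^2 + bij + j^2, so up to a nonzero
square D_p(b, 1) is the group determinant of F_p^* attached to 1 / f(t), with
f(t) = t^2 + bt + 1; its eigenvalues are lambda_k = sum_t t^k / f(t) for
1 <= k <= p - 1. If a, 1/a are the roots of f in an extension, irreducibility
gives a^p = 1/a, and partial fractions give
lambda_k = - (a^k + a^-k) / (b^2 - 4). This is nonzero, because a^(2k) = -1
contradicts a^(p+1) = 1 with (p + 1) / 2 odd, and lambda_(p+1-k) = lambda_k. So
only the fixed points k = 1 and k = (p + 1) / 2 matter modulo squares; they
contribute b / (b^2 - 4) and -2 (+-1) / (b^2 - 4), and -1 is a square. *)

Set Implicit Arguments.
Unset Strict Implicit.
Unset Printing Implicit Defensive.

Import GRing.Theory.
Local Open Scope ring_scope.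

(** * Power sums over a finite field *)

(** ['X^k - 1] has at most [k] roots, fewer than there are nonzero elements. *)
Lemma exists_expf_neq1 (F : finFieldType) (k : nat) :
  (0 < k < #|F|.-1)%N -> exists2 x : F, x != 0 & x ^+ k != 1.
Proof.
case/andP=> k_gt0 k_lt.
apply/exists_inP; apply: contraT => /exists_inPn xk1.
have sz : size ('X^k - 1 : {poly F}) = k.+1 by rewrite size_XnsubC.
have : (size (enum (predC1 (0%R : F))) < k.+1)%N.
  rewrite -sz; apply: max_poly_roots; last exact: enum_uniq.
    by rewrite -size_poly_eq0 sz.
  apply/allP => x; rewrite mem_enum => /xk1; rewrite negbK => /eqP xk.
  by rewrite rootE !hornerE xk subrr.
by rewrite -cardE cardC1 ltnS leqNgt k_lt.
Qed.

(** Scaling by [x] with [x ^+ k != 1] permutes the nonzero elements, yet multiplies the sum by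
    [x ^+ k]. *)
Lemma sum_expf_eq0 (F : finFieldType) (k : nat) :
  (0 < k < #|F|.-1)%N -> \sum_(t : F | t != 0) t ^+ k = 0.
Proof.
case/exists_expf_neq1 => x x0 xk.
have : x ^+ k * \sum_(t : F | t != 0) t ^+ k = \sum_(t : F | t != 0) t ^+ k.
  rewrite mulr_sumr [RHS](reindex_onto ( *%R x) ( *%R x^-1)) /=; last first.
    by move=> t _; rewrite mulVKf.
  apply: eq_big => [t|t _]; last by rewrite exprMn.
  by rewrite mulf_eq0 negb_or x0 mulKf // eqxx andbT.
move/eqP; rewrite -subr_eq0 -{2}[\sum_(t | _) _]mul1r -mulrBl mulf_eq0.
by rewrite subr_eq0 (negPf xk) => /eqP.
Qed.

Lemma expf_card_pred (F : finFieldType) (x : F) : x != 0 -> x ^+ #|F|.-1 = 1.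
Proof.
move=> x0; apply: (mulfI x0); rewrite -exprS prednK ?expf_card ?mulr1 //.
exact: ltnW (finNzRing_gt1 F).
Qed.

(** Translation by 1 permutes the field, but adds [#|F|] ones to the sum of all elements. *)
Lemma natf_card_eq0 (F : finFieldType) : #|F|%:R = 0 :> F.
Proof.
apply: (addrI (\sum_(t : F) t)); rewrite addr0.
rewrite [RHS](reindex_inj (addIr 1)) big_split /=.
by rewrite sumr_const.
Qed.

Lemma sum_expf_card_pred (F : finFieldType) :
  \sum_(t : F | t != 0) t ^+ #|F|.-1 = -1.
Proof.
under eq_bigr => t t0 do rewrite expf_card_pred //.
rewrite sumr_const cardC1.
apply: (addIr 1); rewrite addNr -mulrSr prednK; last exact: ltnW (finNzRing_gt1 F).
exact: natf_card_eq0.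
Qed.

(** * Sums of simple fractions with a pole outside the field *)

(** ['X^#|F| - 'X] is the product of all ['X - t] with [t] in [F], and [iota] carries this
    factorisation to [L]. *)
Lemma card_fixed_in_image (F : finFieldType) (L : fieldType)
    (iota : {rmorphism F -> L}) (a : L) :
  a ^+ #|F| = a -> exists t, a = iota t.
Proof.
move=> aF; have : root (map_poly iota ('X^#|F| - 'X)) a.
  by rewrite rmorphB /= map_polyXn map_polyX rootE !hornerE aF subrr.
rewrite finField_genPoly rmorph_prod rootE horner_prod prodf_seq_eq0.
case/hasP=> t _ /=; rewrite rmorphB /= map_polyX map_polyC !hornerE subr_eq0.
by move/eqP; exists t.
Qed.

(* Multiplying the k-th sum by [a] gives the next one up to a power sum, and
   exponents 1 and #|F| give the same sum. *)
Lemma sum_expf_div_sub (F : finFieldType) (L : fieldType)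
    (iota : {rmorphism F -> L}) (a : L) (k : nat) :
  a ^+ #|F| != a -> (0 < k < #|F|)%N ->
  \sum_(t : F | t != 0) iota t ^+ k / (iota t - a) = a ^+ k / (a ^+ #|F| - a).
Proof.
move=> aF /andP[k0 kF]; set S := fun k =>
  \sum_(t | t != 0) iota t ^+ k / (iota t - a).
have ta t : iota t - a != 0.
  apply: contraNneq aF => /subr0_eq <-.
  by rewrite -rmorphXn expf_card.
have SS j : S j.+1 = a * S j + iota (\sum_(t : F | t != 0) t ^+ j).
  rewrite rmorph_sum /S mulr_sumr -big_split /=; apply: eq_bigr => t _.
  by rewrite rmorphXn exprS; field; apply: ta.
have F1 := finNzRing_gt1 F.
have SE j : (j < #|F|.-1)%N -> S j.+1 = a ^+ j * S 1%N.
  elim: j => [|j IHj] jF; first by rewrite mul1r.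
  rewrite SS sum_expf_eq0 ?rmorph0 ?addr0 ?IHj ?exprS ?mulrA //; lia.
(* The recurrence closes up as [S 1 = a ^+ (#|F| - 1) * S 1 - 1]. *)
have S1 : S 1%N * (a ^+ #|F| - a) = a.
  have : S #|F| = S 1%N.
    by apply: eq_bigr => t _; rewrite -rmorphXn expf_card.
  rewrite -{1}[#|F|]prednK; last by lia.
  rewrite SS sum_expf_card_pred rmorphN1 -{1}[#|F|.-1]prednK; last by lia.
  rewrite SE; last by lia.
  rewrite mulrA -exprS prednK => [SE1|]; last by lia.
  rewrite -[in LHS](prednK (ltnW F1)) exprS.
  rewrite mulrC -[X in _ - X]mulr1 -mulrBr -mulrA mulrBl mul1r -{2}SE1.
  by ring.
rewrite -/(S k) -(prednK k0) SE; last by lia.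
rewrite -[in RHS](prednK k0) exprSr -mulrA; congr (_ * _).
by apply: (canRL (mulfK _) S1); rewrite subr_eq0.
Qed.

(** * Closed form of the eigenvalues *)

(** The eigenvalue [lambda_k], attached to the character [t |-> t ^+ k]. *)
Definition quadratic_power_sum (F : finFieldType) (b : F) (k : nat) : F :=
  \sum_(t : F | t != 0) t ^+ k / (t ^+ 2 + b * t + 1).

Lemma expFp (p : nat) (x : 'F_p) : prime p -> x ^+ p = x.
Proof. by move=> p_pr; have := expf_card x; rewrite card_Fp. Qed.

Lemma reciprocal_root_neq0 (L : fieldType) (a c : L) :
  a ^+ 2 + c * a + 1 = 0 -> a != 0.
Proof.
by apply: contra_eq_neq => ->; rewrite expr0n mulr0 !add0r oner_neq0.
Qed.

(** By irreducibility [a] is not in the image of [iota], hence [a ^+ p != a]. Frobenius fixes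
    [iota b], so [a ^+ p] is the other root, and the roots have product 1. *)
Lemma Frobenius_root_inv (p : nat) (L : fieldType)
    (iota : {rmorphism 'F_p -> L}) (b : 'F_p) (a : L) :
  prime p -> (forall t : 'F_p, t ^+ 2 + b * t + 1 != 0) ->
  a ^+ 2 + iota b * a + 1 = 0 -> a ^+ p = a^-1 /\ a ^+ p != a.
Proof.
move=> p_pr irr fa.
have ap : a ^+ p != a.
  apply/eqP => apa; have [|t at_] := @card_fixed_in_image _ _ iota a.
    by rewrite card_Fp.
  move: fa; rewrite at_ -rmorphXn -rmorphM -rmorphD -(rmorph1 iota) -rmorphD.
  by move/eqP; rewrite fmorph_eq0 (negPf (irr t)).
split=> //.
have a0 := reciprocal_root_neq0 fa.
have charL : p \in [pchar L].
  by rewrite (fmorph_pchar iota) pchar_Fp.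
have fap : (a ^+ p) ^+ 2 + iota b * a ^+ p + 1 = 0.
  have bp : iota b = iota b ^+ p by rewrite -rmorphXn expFp.
  rewrite bp -exprMn exprAC -[X in _ + X](expr1n _ p) -!(pFrobenius_autE charL).
  by rewrite -!pFrobenius_autD_comm ?fa ?pFrobenius_aut0 //; apply: mulrC.
(* Subtracting the two equations exposes the factor [a ^+ p - a], which can be cancelled. *)
have := congr2 (fun x y => x - y) fap fa.
have -> : (a ^+ p) ^+ 2 + iota b * a ^+ p + 1 - (a ^+ 2 + iota b * a + 1)
          = (a ^+ p - a) * (a ^+ p + a + iota b) by ring.
rewrite subrr => /eqP; rewrite mulf_eq0 subr_eq0 (negPf ap) /= => /eqP apb.
apply: (mulIf a0); rewrite mulVf //.
have -> : a ^+ p = - (a + iota b).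
  by apply/eqP; rewrite -subr_eq0 -apb; apply/eqP; ring.
apply/eqP; rewrite -subr_eq0 -oppr_eq0 -fa; apply/eqP; ring.
Qed.

(** Partial fractions reduce this to [sum_expf_div_sub] at the poles [a] and [a^-1], which Frobenius
    exchanges. *)
Lemma quadratic_power_sumE (p : nat) (L : fieldType)
    (iota : {rmorphism 'F_p -> L}) (b : 'F_p) (a : L) (k : nat) :
  prime p -> (forall t : 'F_p, t ^+ 2 + b * t + 1 != 0) ->
  a ^+ 2 + iota b * a + 1 = 0 -> (0 < k < p)%N ->
  iota (quadratic_power_sum b k) = - (a ^+ k + a ^- k) / (a - a^-1) ^+ 2.
Proof.
move=> p_pr irr fa kp.
have [apE ap] := Frobenius_root_inv p_pr irr fa.
have a0 := reciprocal_root_neq0 fa.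
have aV : a^-1 - a != 0 by rewrite subr_eq0 -apE.
have aV' : a - a^-1 != 0 by rewrite -oppr_eq0 opprB.
have vp : a^-1 ^+ p = a by rewrite exprVn apE invrK.
have Sa := @sum_expf_div_sub _ _ iota a k; rewrite card_Fp // in Sa.
have Sv := @sum_expf_div_sub _ _ iota a^-1 k; rewrite card_Fp // in Sv.
have nFa c : c ^+ p != c -> forall t, iota t - c != 0.
  move=> cp t; apply: contraNneq cp => /subr0_eq <-.
  by rewrite -rmorphXn expFp.
have vn : a^-1 ^+ p != a^-1 by rewrite vp -subr_eq0.
transitivity ((\sum_(t : 'F_p | t != 0) iota t ^+ k / (iota t - a)
  - \sum_(t : 'F_p | t != 0) iota t ^+ k / (iota t - a^-1)) / (a - a^-1)).
  rewrite -sumrB mulr_suml rmorph_sum; apply: eq_bigr => t _.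
  rewrite rmorphM fmorphV rmorphXn !rmorphD rmorphXn rmorphM rmorph1.
  have -> : iota t ^+ 2 + iota b * iota t + 1 = (iota t - a) * (iota t - a^-1).
    have -> : iota b = - (a ^+ 2 + 1) / a.
      apply: (canRL (mulfK a0)); apply/eqP; rewrite -subr_eq0 -fa; apply/eqP; ring.
    by field.
  have h1 := nFa _ ap t; have h2 := nFa _ vn t.
  move: h1 h2 aV'; move: (a^-1) => v h1 h2 h3.
  by field; rewrite h1 h2 h3.
rewrite Sa // Sv // apE vp exprVn -[a^-1 - a]opprB.
move: (a - a^-1) (a ^+ k) (a ^- k) aV' => d u v d0.
by field; rewrite oppr_eq0 d0.
Qed.

(** * Nonvanishing and pairing of the eigenvalues *)

Lemma trace_expr_neq0 (L : fieldType) (a : L) (m k : nat) :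
  2 != 0 :> L -> a ^+ (4 * m + 2) = 1 -> a ^+ k + a ^- k != 0.
Proof.
move=> two0 am; have a0 : a != 0.
  by apply: contra_eq_neq am => ->; rewrite expr0n addn2 eq_sym oner_neq0.
have ak0 : a ^+ k != 0 by rewrite expf_neq0.
apply/eqP => akV.
have a2k : (a ^+ k) ^+ 2 = -1.
  by apply/eqP; rewrite -subr_eq0 opprK -(mulfV ak0) expr2 -mulrDr akV mulr0.
(* This exponent yields a power of [a ^+ (4 * m + 2)]; being odd, it also keeps -1 fixed. *)
have : ((a ^+ k) ^+ 2) ^+ (2 * m).+1 = 1.
  rewrite -!exprM (_ : (k * (2 * _.+1) = (4 * m + 2) * k)%N) ?exprM ?am ?expr1n //.
  by lia.
rewrite a2k exprS exprM sqrrN !expr1n mulr1 => /eqP.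
by rewrite -subr_eq0 -opprD oppr_eq0 (negPf two0).
Qed.

(** The reflection [k |-> 4 * m + 2 - k] preserves the range from 2 to [4 * m] and fixes only
    [2 * m + 1]; the partner of 1 lies outside the product. *)
Lemma prod_symmetric (R : comNzRingType) (u : nat -> R) (m : nat) :
  (0 < m)%N ->
  (forall k, (1 < k <= 4 * m)%N -> u (4 * m + 2 - k)%N = u k) ->
  \prod_(k < 4 * m) u k.+1 =
    u 1%N * u (2 * m).+1 * (\prod_(2 <= k < (2 * m).+1) u k) ^+ 2.
Proof.
move=> m0 usym.
rewrite -(big_mkord xpredT (fun k => u k.+1)) -(big_add1 _ _ 0%N (4 * m).+1 xpredT u).
rewrite big_ltn; last by lia.
rewrite (@big_cat_nat _ _ _ (2 * m).+1) /=; [|lia..].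
rewrite [X in _ * (_ * X)]big_ltn; last by lia.
have -> : \prod_((2 * m).+2 <= k < (4 * m).+1) u k = \prod_(2 <= k < (2 * m).+1) u k.
  rewrite big_nat_rev -[(2 * m).+2]/(2 + 2 * m)%N big_addn.
  rewrite (_ : ((4 * m).+1 - 2 * m = (2 * m).+1)%N); last by lia.
  apply: eq_big_nat => k kP; rewrite -usym; last by lia.
  by congr u; lia.
ring.
Qed.

(** * Diagonalisation of the group determinant *)

Lemma sum_nonzero_reindex (F : finFieldType) (V : nmodType)
    (n : nat) (x : 'I_n -> F) (G : F -> V) :
  #|F|.-1 = n -> injective x -> (forall i, x i != 0) ->
  \sum_i G (x i) = \sum_(t | t != 0) G t.
Proof.
move=> Fn x_inj x0.
have xE : x @: setT = [set~ 0].
  apply/eqP; rewrite eqEcard cardsC1 card_imset // cardsT card_ord Fn leqnn andbT.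
  by apply/subsetP => _ /imsetP[i _ ->]; rewrite in_setC1.
transitivity (\sum_(t in x @: setT) G t); last first.
  by rewrite xE; apply: eq_bigl => t; rewrite in_setC1.
by rewrite big_imset /= => [|? ? _ _ /x_inj //]; apply: eq_bigl => i; rewrite inE.
Qed.

(* The inverse of the form is [x j ^- 2 * g (x i / x j)] with [g t] the inverse
   of [t ^+ 2 + b * t + 1], so up to the factors [x j ^- 2] this is a group
   determinant, diagonalised by the characters [t |-> t ^+ k]. *)
Lemma det_quadratic_form_inv (F : finFieldType) (b : F) (n : nat) (x : 'I_n -> F) :
  #|F|.-1 = n -> injective x -> (forall i, x i != 0) ->
  \det (\matrix_(i, j) (x i ^+ 2 + b * x i * x j + x j ^+ 2)^-1) =
    (\prod_j (x j)^-1) ^+ 2 * \prod_(k < n) quadratic_power_sum b k.+1.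
Proof.
move=> Fn x_inj x0; set E := \matrix_(i, j) _.
pose V := \matrix_(k, i) x i ^+ k.+1 : 'M_n.
pose Lam := \row_(k < n) quadratic_power_sum b k.+1.
pose X := \row_j x j ^- 2.
have VE : V *m E = diag_mx Lam *m V *m diag_mx X.
  rewrite mul_mx_diag mul_diag_mx; apply/matrixP => k j; rewrite !mxE.
  under eq_bigr => i _ do rewrite !mxE.
  pose G t := t ^+ k.+1 * (t ^+ 2 + b * t * x j + x j ^+ 2)^-1.
  rewrite (sum_nonzero_reindex G Fn x_inj x0).
  rewrite (reindex_onto ( *%R (x j)) ( *%R (x j)^-1)) /=; last first.
    by move=> t _; rewrite mulVKf.
  rewrite /quadratic_power_sum !mulr_suml; apply: eq_big => [t|t _].
    by rewrite mulf_eq0 negb_or x0 mulKf // eqxx andbT.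
  have -> : G (x j * t) = (x j * t) ^+ k.+1 / (x j ^+ 2 * (t ^+ 2 + b * t + 1)).
    by congr (_ / _); ring.
  rewrite invfM exprMn; ring.
have detV : \det V != 0.
  (* The exponents in [V] start at 1, so column [i] carries an extra factor [x i]. *)
  have -> : V = Vandermonde _ (\row_i x i) *m diag_mx (\row_i x i).
    by apply/matrixP => k i; rewrite mul_mx_diag !mxE exprSr.
  rewrite det_mulmx det_Vandermonde det_diag mulf_neq0 //.
    apply/prodf_neq0 => i _; apply/prodf_neq0 => j ij.
    rewrite !mxE subr_eq0 (inj_eq x_inj).
    by apply: contraTneq ij => ->; rewrite ltnn.
  by apply/prodf_neq0 => i _; rewrite mxE.
apply: (mulfI detV); rewrite -det_mulmx VE !det_mulmx !det_diag.
under eq_bigr do rewrite mxE.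
under [\prod_j _ 0 j]eq_bigr do rewrite mxE expr2 invfM.
rewrite big_split /= expr2; ring.
Qed.

(** * Legendre symbols and reduction modulo [p] *)

Lemma intr_Fp_eq0 (p : nat) (a : int) :
  prime p -> (a%:~R == 0 :> 'F_p) = (p%:Z %| a)%Z.
Proof.
move=> p_pr; rewrite dvdzE /= (dvdn_pcharf (pchar_Fp p_pr)).
case: a => n //.
by rewrite NegzE abszN mulrNz oppr_eq0 -pmulrn.
Qed.

Lemma legendreE (p : nat) (a : int) : prime p ->
  legendre a p = if a%:~R == 0 :> 'F_p then 0 else
                 if [exists y : 'F_p, y ^+ 2 == a%:~R] then 1 else -1.
Proof.
move=> p_pr; rewrite /legendre -intr_Fp_eq0 //; case: ifP => // _.
congr (if _ then _ else _); apply/existsP/existsP => [[x]|[y]].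
  rewrite eqz_mod_dvd -intr_Fp_eq0 // rmorphB rmorphXn subr_eq0 /= => xa.
  by exists x%:R; rewrite pmulrn.
move=> ya; have yp : (y < p)%N by rewrite -[X in (_ < X)%N](Fp_cast p_pr).
exists (Ordinal yp); rewrite eqz_mod_dvd -intr_Fp_eq0 // rmorphB rmorphXn subr_eq0 /=.
by rewrite -pmulrn natr_Zp.
Qed.

Lemma legendre_mul_square (p : nat) (a c : int) (s : 'F_p) : prime p ->
  s != 0 -> a%:~R = s ^+ 2 * c%:~R :> 'F_p -> legendre a p = legendre c p.
Proof.
move=> p_pr s0 ac; rewrite !legendreE // ac mulf_eq0 expf_eq0 (negPf s0) /=.
suff -> : [exists y, y ^+ 2 == s ^+ 2 * c%:~R] =
          [exists y : 'F_p, y ^+ 2 == c%:~R] by [].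
apply/existsP/existsP => [[y /eqP yc]|[y /eqP yc]].
  by exists (y / s); rewrite expr_div_n yc mulrC mulKf // expf_neq0.
by exists (s * y); rewrite exprMn yc.
Qed.

(** If [x ^+ (2 * m) != 1], this power is -1, since its square is 1; so [x ^+ m] is a root. *)
Lemma sqrtN1_exists (F : finFieldType) (m : nat) :
  (0 < m)%N -> #|F|.-1 = (4 * m)%N -> exists z : F, z ^+ 2 = -1.
Proof.
move=> m0 Fm; have [|x x0 xm] := @exists_expf_neq1 F (2 * m); first by lia.
exists (x ^+ m); apply/eqP; rewrite -exprM mulnC.
have /eqP : (x ^+ (2 * m)) ^+ 2 = 1.
  by rewrite -exprM (_ : (2 * m * 2 = #|F|.-1)%N) ?expf_card_pred //; lia.
by rewrite sqrf_eq1 (negPf xm).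
Qed.

Lemma expf_card_sub2 (F : finFieldType) (x : F) : (2 < #|F|)%N ->
  x ^+ (#|F| - 2) = x^-1.
Proof.
move=> F2; have [->|x0] := eqVneq x 0.
  (* The inverse of 0 is 0 by convention, and the exponent is positive. *)
  by rewrite expr0n invr0; case: eqP => //; lia.
apply: (mulIf x0); rewrite -exprSr mulVf // -(expf_card_pred x0); congr (_ ^+ _).
by lia.
Qed.

Lemma intr_D (p : nat) (b : int) : prime p -> (2 < p)%N ->
  (D p b 1)%:~R = \det (\matrix_(i < p.-1, j < p.-1)
     ((i.+1)%:R ^+ 2 + b%:~R * (i.+1)%:R * (j.+1)%:R + (j.+1)%:R ^+ 2)^-1 : 'M['F_p]_p.-1).
Proof.
move=> p_pr p2; rewrite /D -det_map_mx; congr (\det _); apply/matrixP => i j.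
rewrite !mxE mul1r rmorphXn !rmorphD !rmorphXn !rmorphM /=.
by have := @expf_card_sub2 'F_p; rewrite card_Fp // => ->.
Qed.

(** * Evaluation of the determinant modulo squares *)

Theorem theorem1p2 (p : nat) (b : int) :
  prime p -> p = 1 %[mod 4] ->
  legendre (b ^+ 2 - 4) p = -1 ->
  legendre (D p b 1) p = legendre (2 * b) p.
Proof.
move=> p_pr p1 disc.
pose m := (p %/ 4)%N; have pE : p = (4 * m).+1.
  by rewrite {1}(divn_eq p 4) p1 mulnC addn1.
have m0 : (0 < m)%N by have := prime_gt1 p_pr; lia.
pose B : 'F_p := b%:~R.
have irr (t : 'F_p) : t ^+ 2 + B * t + 1 != 0.
  apply/eqP => tB; move: disc; rewrite legendreE //; case: eqP => // _.
  (* Completing the square: [(2 * t + B) ^+ 2 - (B ^+ 2 - 4)] is 4 times the quadratic at [t]. *)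
  case: existsP => // [[]]; exists (2 * t + B).
  rewrite rmorphB rmorphXn /= -/B -subr_eq0.
  have -> : (4 : int)%:~R = 4 :> 'F_p by [].
  by apply/eqP; rewrite -[RHS](mulr0 4) -tB; ring.
have [L [iota _]] := countable_algebraic_closure 'F_p.
have [a fa] : exists a : L, a ^+ 2 + iota B * a + 1 = 0.
  (* [solve_monicpoly] solves [a ^+ 2 = c_0 + c_1 * a], hence the negated coefficients. *)
  have [a] := @solve_monicpoly L 2%N (fun i => if i == 0%N then -1 else - iota B) isT.
  rewrite !big_ord_recr big_ord0 /= => aE.
  by exists a; rewrite aE; ring.
have [apE ap] := Frobenius_root_inv p_pr irr fa.
have sumE k := @quadratic_power_sumE _ _ iota B a k p_pr irr fa.
have a0 := reciprocal_root_neq0 fa.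
have am : a ^+ (4 * m + 2) = 1.
  by rewrite addn2 -pE exprSr apE mulVf.
have two0 : 2 != 0 :> 'F_p.
  by rewrite -(dvdn_pcharf (pchar_Fp p_pr)) gtnNdvd //; lia.
have two0L : 2 != 0 :> L by rewrite -(rmorph_nat iota) fmorph_eq0.
have aV : a - a^-1 != 0 by rewrite subr_eq0 eq_sym -apE.
pose u := quadratic_power_sum B.
have u0 k : (0 < k < p)%N -> u k != 0.
  move=> kp; rewrite -(fmorph_eq0 iota) sumE // mulf_neq0 ?invr_eq0 ?expf_neq0 //.
  by rewrite oppr_eq0 (trace_expr_neq0 _ two0L am).
have usym k : (1 < k <= 4 * m)%N -> u (4 * m + 2 - k)%N = u k.
  move=> kp; apply: (fmorph_inj iota); rewrite !sumE; [|lia..].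
  have -> : a ^+ (4 * m + 2 - k) = a ^- k.
    apply: (mulIf (expf_neq0 k a0)); rewrite -exprD subnK ?am ?mulVf ?expf_neq0 //.
    lia.
  by rewrite invrK [in LHS]addrC.
have iB : iota B = - (a + a^-1).
  apply: (mulIf a0); rewrite mulNr mulrDl mulVf //.
  by apply/eqP; rewrite -subr_eq0 -fa; apply/eqP; ring.
have iD : iota (B ^+ 2 - 4) = (a - a^-1) ^+ 2.
  by rewrite rmorphB rmorphXn (rmorph_nat iota 4) iB; field.
have D0 : B ^+ 2 - 4 != 0 by rewrite -(fmorph_eq0 iota) iD expf_neq0.
have u1 : u 1%N = B / (B ^+ 2 - 4).
  apply: (fmorph_inj iota); rewrite fmorph_div iD iB sumE ?expr1 //.
  exact: prime_gt1.
have [z z2] : exists z : 'F_p, z ^+ 2 = -1.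
  by apply: (@sqrtN1_exists _ m) => //; rewrite card_Fp // pE.
(* At the fixed index, [a ^+ (2 * m).+1] is 1 or -1; [w] is [z] or 1 accordingly, absorbing the
   sign. *)
have [w w0 um] : exists2 w : 'F_p, w != 0 & u (2 * m).+1 = w ^+ 2 * 2 / (B ^+ 2 - 4).
  have eV : a ^- (2 * m).+1 = a ^+ (2 * m).+1.
    apply: (mulIf (expf_neq0 (2 * m).+1 a0)).
    by rewrite mulVf ?expf_neq0 // -exprD -am; congr (_ ^+ _); lia.
  have ue : iota (u (2 * m).+1) = - (2 * a ^+ (2 * m).+1) / iota (B ^+ 2 - 4).
    by rewrite sumE ?eV -?mulr2n ?mulr_natl ?iD //; lia.
  have : (a ^+ (2 * m).+1) ^+ 2 == 1.
    by rewrite -exprM -am; apply/eqP; congr (_ ^+ _); lia.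
  rewrite sqrf_eq1 => /orP[] /eqP e.
    exists z.
      apply: contra_eq_neq z2 => ->.
      by rewrite expr0n eq_sym oppr_eq0 oner_neq0.
    apply: (fmorph_inj iota); rewrite ue e z2 mulr1 fmorph_div rmorphM rmorphN1.
    by rewrite (rmorph_nat iota 2) mulN1r.
  exists 1; first exact: oner_neq0.
  apply: (fmorph_inj iota); rewrite ue e expr1n mul1r fmorph_div.
  by rewrite (rmorph_nat iota 2) mulrN1 opprK.
pose x (i : 'I_p.-1) : 'F_p := (i.+1)%:R.
have x_inj : injective x.
  move=> i j /(congr1 val); have := (ltn_ord i, ltn_ord j).
  rewrite /= !val_Fp_nat // => -[ip jp]; rewrite !modn_small; [|lia..].
  by move=> [] /val_inj.
have x0 i : x i != 0.
  by rewrite -(dvdn_pcharf (pchar_Fp p_pr)) gtnNdvd //; have := ltn_ord i; lia.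
have Fn : #|'F_p|.-1 = p.-1 by rewrite card_Fp.
have DE := det_quadratic_form_inv B Fn x_inj x0.
pose P := \prod_(2 <= k < (2 * m).+1) u k.
pose X := \prod_j (x j)^-1.
have PE : \prod_(k < p.-1) u k.+1 = u 1%N * u (2 * m).+1 * P ^+ 2.
  by rewrite (_ : p.-1 = 4 * m)%N ?prod_symmetric //; lia.
(* [u 1] and [u (2 * m).+1] each contribute a denominator [B ^+ 2 - 4], so together these form a
   square and [2 * B] remains. *)
apply: (@legendre_mul_square _ _ _ (X * P * w / (B ^+ 2 - 4))) => //.
  rewrite !mulf_neq0 ?invr_eq0 //.
    by apply/prodf_neq0 => j _; rewrite invr_eq0.
  rewrite /P big_nat; apply: (big_ind (fun y => y != 0)) => [|y y'|k kP].
  - exact: oner_neq0.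
  - exact: mulf_neq0.
  - by apply: u0; lia.
rewrite rmorphM -/B intr_D //; last by lia.
by rewrite DE -/u PE u1 um -/X; field.
Qed.
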